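(* Let $\tilde B=\begin{pmatrix}0&-2&2\\2&0&-2\\-2&2&0\end{pmatrix}$ (the Markov exchange matrix, with no frozen variables). Then the cluster algebra $A$ and the upper cluster algebra $U$ of $\tilde B$ have no mysterious points; that is, $\mathcal D(\operatorname{Spec}A)=\mathcal S(\operatorname{Spec}A)$ and $\mathcal D(\operatorname{Spec}U)=\mathcal S(\operatorname{Spec}U)$.
   Context: For an extended exchange matrix $\tilde B=(b_{ij})$ (an $(n+m)\times n$ integer matrix with skew-symmetric top $n\times n$ block), a seed is $(\tilde{\mathbf x},\tilde B)$ with $\tilde{\mathbf x}=(x_1,\dots,x_{n+m})$ freely generating $\mathcal F=\mathbb{C}(x_1,\dots,x_{n+m})$; mutation at $k\le n$ performs matrix mutation and replaces $x_k$ by $x_k^{-1}\big(\prod_{b_{ik}>0}x_i^{b_{ik}}+\prod_{b_{ik}<0}x_i^{-b_{ik}}\big)$. The cluster algebra $A$ is the $\mathbb{C}[x_{n+1}^{\pm1},\dots,x_{n+m}^{\pm1}]$-subalgebra of $\mathcal F$ generated by all cluster variables of the set $\Sigma(A)$ of seeds obtained by iterated mutation. The upper cluster algebra is $U=\bigcap_{(\tilde{\mathbf z},\tilde B')\in\Sigma(A)}\mathbb{C}[z_1^{\pm1},\dots,z_{n+m}^{\pm1}]\supseteq A$. Put $\mathcal A=\operatorname{Spec}A$, $\mathcal U=\operatorname{Spec}U$. For $t\in\Sigma(A)$ the cluster torus $T(t)$ embeds in both $\mathcal A$ and $\mathcal U$ as the open locus where all variables of $t$ are nonzero; the deep loci are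 $\mathcal D(\mathcal A)=\mathcal A\setminus\bigcup_tT(t)$ and $\mathcal D(\mathcal U)=\mathcal U\setminus\bigcup_tT(t)$. $\operatorname{Aut}(A)$ is the group of algebra automorphisms of $A$ sending every (mutable or frozen) variable to a nonzero scalar multiple of itself; it acts also on $U$. $\mathcal S(\mathcal A)$ and $\mathcal S(\mathcal U)$ are the sets of points of $\mathcal A$, resp. $\mathcal U$, with nontrivial $\operatorname{Aut}(A)$-stabilizer. *)

(* Defs.v *)
From HB Require Import structures.
From mathcomp Require Import all_boot all_order all_algebra.
From mathcomp Require Import mpoly complex.
From mathcomp Require Import boolp classical_sets reals.

Set Implicit Arguments.
Unset Strict Implicit.
Unset Printing Implicit Defensive.

Import Order.TTheory GRing.Theory Num.Theory.
Local Open Scope ring_scope.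

Section RationalFunctions.
Variables (K : fieldType) (N : nat).

Definition ratfun : Type := {fraction {mpoly K[N]}}.

HB.instance Definition _ := GRing.Field.on ratfun.

Definition ratfun_const (c : K) : ratfun := tofrac (c%:MP).

Definition ratfun_var (i : 'I_N) : ratfun := tofrac ('X_i).

Definition ratfun_scale (c : K) (f : ratfun) : ratfun := ratfun_const c * f.

Fact ratfun_scaleA c d f :
  ratfun_scale c (ratfun_scale d f) = ratfun_scale (c * d) f.
Proof.
by rewrite /ratfun_scale /ratfun_const mulrA -[in LHS]tofracM mpolyCM.
Qed.

Fact ratfun_scale1 : left_id 1 ratfun_scale.
Proof. by move=> f; rewrite /ratfun_scale /ratfun_const mpolyC1 tofrac1 mul1r. Qed.

Fact ratfun_scaleDr : right_distributive ratfun_scale +%R.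
Proof. by move=> c f g; rewrite /ratfun_scale mulrDr. Qed.

Fact ratfun_scaleDl f : {morph ratfun_scale^~ f : c d / c + d}.
Proof.
by move=> c d; rewrite /ratfun_scale /ratfun_const mpolyCD tofracD mulrDl.
Qed.

HB.instance Definition _ := GRing.Zmodule_isLmodule.Build K ratfun
  ratfun_scaleA ratfun_scale1 ratfun_scaleDr ratfun_scaleDl.

Fact ratfun_scaleAl (c : K) (f g : ratfun) : c *: (f * g) = (c *: f) * g.
Proof. exact: mulrA. Qed.

HB.instance Definition _ := GRing.Lmodule_isLalgebra.Build K ratfun
  ratfun_scaleAl.

Fact ratfun_scaleAr (c : K) (f g : ratfun) : c *: (f * g) = f * (c *: g).
Proof. exact: mulrCA. Qed.

HB.instance Definition _ := GRing.Lalgebra_isAlgebra.Build K ratfun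
  ratfun_scaleAr.

End RationalFunctions.

Section Subalgebras.
Variables (K : fieldType) (V : comAlgType K).

Definition generated_subalg (G : set V) : {pred V} := fun f =>
  `[< forall P : {pred V}, GRing.subalg_closed P ->
        (forall g, G g -> g \in P) -> f \in P >].

Fact generated_subalg_closed G : GRing.subalg_closed (generated_subalg G).
Proof.
split; first by apply/asboolP=> P [].
- move=> c f g /asboolP Hf /asboolP Hg; apply/asboolP=> P PV PG.
  by case: (PV) => _ Plin _; apply: Plin; [apply: Hf | apply: Hg].
- move=> f g /asboolP Hf /asboolP Hg; apply/asboolP=> P PV PG.
  by case: (PV) => _ _ Pmul; apply: Pmul; [apply: Hf | apply: Hg].
Qed.

HB.instance Definition _ G := GRing.isSubalgClosed.Build K V
  (generated_subalg G) (generated_subalg_closed G).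

Definition subalg_type (P : subalgClosed V) : Type := {f : V | f \in P}.

Variable P : subalgClosed V.

HB.instance Definition _ := SubChoice.on (subalg_type P).
HB.instance Definition _ := [SubChoice_isSubAlgebra of subalg_type P by <:].
HB.instance Definition _ := [SubNzRing_isSubComNzRing of subalg_type P by <:].

End Subalgebras.

Section ClusterAlgebras.
Variables (K : fieldType) (n m : nat).

Notation F := (ratfun K (n + m)).

Record seed := Seed {
  seed_var : 'I_(n + m) -> F;
  seed_mx : 'M[int]_(n + m, n)
}.

Definition mutate_mx (k : 'I_n) (B : 'M[int]_(n + m, n)) :
    'M[int]_(n + m, n) :=
  \matrix_(i, j)
    if (i == lshift m k) || (j == k) then - B i j
    else B i j + Num.sg (B i k) * Num.max 0 (B i k * B (lshift m k) j).

Definition mutate (k : 'I_n) (s : seed) : seed :=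
  let x := seed_var s in
  let B := seed_mx s in
  Seed
    (fun i => if i == lshift m k then
       (x i)^-1 * (\prod_(j | 0 < B j k) x j ^ B j k
                   + \prod_(j | B j k < 0) x j ^ (- B j k))
     else x i)
    (mutate_mx k B).

Variable B : 'M[int]_(n + m, n).

Definition initial_seed : seed := Seed (@ratfun_var K (n + m)) B.

Inductive reachable : seed -> Prop :=
| reachable_initial : reachable initial_seed
| reachable_mutate k s : reachable s -> reachable (mutate k s).

(* Mutation never changes the variables with index [rshift n j], so the frozen
   variables can be taken from the initial seed. *)
Definition cluster_generator : set F := fun f =>
  (exists s (i : 'I_n), reachable s /\ f = seed_var s (lshift m i)) \/
  (exists j : 'I_m, f = ratfun_var K (rshift n j) \/
                    f = (ratfun_var K (rshift n j))^-1).

Definition in_cluster_algebra : {pred F} := generated_subalg cluster_generator.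

HB.instance Definition _ := GRing.SubalgClosed.on in_cluster_algebra.

Definition laurent_ring (s : seed) : {pred F} :=
  generated_subalg
    (fun f : F => exists i, f = seed_var s i \/ f = (seed_var s i)^-1).

Definition in_upper_cluster_algebra : {pred F} := fun f =>
  `[< forall s, reachable s -> f \in laurent_ring s >].

Fact in_upper_cluster_algebra_closed :
  GRing.subalg_closed in_upper_cluster_algebra.
Proof.
split.
- apply/asboolP=> s _.
  by case: (generated_subalg_closed
    (fun f : F => exists i, f = seed_var s i \/ f = (seed_var s i)^-1)).
- move=> c f g /asboolP Hf /asboolP Hg; apply/asboolP=> s Hs.
  case: (generated_subalg_closed
    (fun f : F => exists i, f = seed_var s i \/ f = (seed_var s i)^-1)).
  by move=> _ Hlin _; apply: Hlin; [apply: Hf | apply: Hg].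
- move=> f g /asboolP Hf /asboolP Hg; apply/asboolP=> s Hs.
  case: (generated_subalg_closed
    (fun f : F => exists i, f = seed_var s i \/ f = (seed_var s i)^-1)).
  by move=> _ _ Hmul; apply: Hmul; [apply: Hf | apply: Hg].
Qed.

HB.instance Definition _ := GRing.isSubalgClosed.Build K F
  in_upper_cluster_algebra in_upper_cluster_algebra_closed.

Definition cluster_algebra : Type := subalg_type in_cluster_algebra.
Definition upper_cluster_algebra : Type := subalg_type in_upper_cluster_algebra.

HB.instance Definition _ :=
  GRing.SubAlgebra.on cluster_algebra.
HB.instance Definition _ := GRing.ComNzRing.on cluster_algebra.
HB.instance Definition _ :=
  GRing.SubAlgebra.on upper_cluster_algebra.
HB.instance Definition _ := GRing.ComNzRing.on upper_cluster_algebra.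

(* Points of Spec are K-points, i.e. K-algebra morphisms to K.  For K the
   complex numbers and a countably generated algebra, these are exactly the
   closed points: every residue field at a maximal ideal is K. *)
Section Points.
Variable P : subalgClosed F.

Definition spec_point := {lrmorphism subalg_type P -> K^o}.

Definition cluster_torus (s : seed) : set spec_point := fun p =>
  forall i, exists2 a : subalg_type P, val a = seed_var s i & p a != 0.

Definition deep_locus : set spec_point := fun p =>
  forall s, reachable s -> ~ cluster_torus s p.

End Points.

Definition cluster_automorphism
    (phi : {lrmorphism cluster_algebra -> cluster_algebra}) : Prop :=
  bijective phi /\
  forall s i (a : cluster_algebra), reachable s -> val a = seed_var s i ->
    exists2 c : K, c != 0 & phi a = c *: a.

(* The action of Aut(A) on U goes through the fraction field of A, which is the
   ambient field F: phi acts on U as psi when both are restrictions of one and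
   the same K-algebra endomorphism of F. *)
Definition acts_on_upper
    (phi : {lrmorphism cluster_algebra -> cluster_algebra})
    (psi : {lrmorphism upper_cluster_algebra -> upper_cluster_algebra}) :
    Prop :=
  exists Phi : {lrmorphism F -> F},
    (forall a : cluster_algebra, Phi (val a) = val (phi a)) /\
    (forall u : upper_cluster_algebra, Phi (val u) = val (psi u)).

(* The stabilizer conditions p \o phi = p and p \o phi^-1 = p are the same. *)
Definition stabilizer_locus : set (spec_point in_cluster_algebra) := fun p =>
  exists phi, [/\ cluster_automorphism phi, ~ phi =1 id & p \o phi =1 p].

Definition upper_stabilizer_locus :
    set (spec_point in_upper_cluster_algebra) := fun p =>
  exists phi psi, [/\ cluster_automorphism phi, ~ phi =1 id,
                      acts_on_upper phi psi & p \o psi =1 p].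

End ClusterAlgebras.

Arguments deep_locus {K n m} B P.
Arguments in_cluster_algebra K {n m} B.
Arguments in_upper_cluster_algebra K {n m} B.
Arguments cluster_algebra K {n m} B.
Arguments upper_cluster_algebra K {n m} B.
Arguments stabilizer_locus K {n m} B.
Arguments upper_stabilizer_locus K {n m} B.

Definition markov_mx : 'M[int]_(3 + 0, 3) :=
  \matrix_(i, j) nth 0 (nth [::] [:: [:: 0; -2; 2];
                                     [:: 2; 0; -2];
                                     [:: -2; 2; 0]] i) j.

Fact markov_mx_skew : (usubmx markov_mx)^T = - usubmx markov_mx.
Proof.
by apply/matrixP; do 2![case; case=> [|[|[|//]]] ?]; rewrite !mxE.
Qed.

(* Main.v *)
(** The element M = (x_1^2 + x_2^2 + x_3^2) / (x_1 x_2 x_3) has the same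
    expression in every cluster, so that mutation reads z_k' = M z_i z_j - z_k.
    The ring R = K[x_1, x_2, x_3, M] is the upper cluster algebra: it lies in
    every Laurent ring, and conversely R is free with basis 1, x_i over the
    polynomial ring K[x_j, x_l, M], which makes (x_i, x_j), (x_i, M) and hence
    (x_i, x_i') regular pairs in R, so that an element of the Laurent rings of
    the initial cluster and its three neighbours has no denominator.

    A point is deep iff either all cluster variables vanish at it, or exactly
    one variable of each cluster vanishes, always in the same position i; in
    the latter case M vanishes as well.  Hence a sign change of the variables
    (of x_i in the second case, of two variables in the first, which fixes M)
    stabilizes the point.  Conversely, an automorphism fixing a point of a
    cluster torus fixes the variables of that cluster, and by the exchange
    relations those of all clusters. *)
Require Import Defs.
From HB Require Import structures.
From mathcomp Require Import all_boot all_order all_algebra.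
From mathcomp Require Import mpoly complex.
From mathcomp Require Import boolp classical_sets reals.
From mathcomp Require Import ring zify.

Set Implicit Arguments.
Unset Strict Implicit.
Unset Printing Implicit Defensive.

Import Order.TTheory GRing.Theory Num.Theory.
Local Open Scope ring_scope.

(** * Extension of injective ring morphisms to fraction fields *)

Section FractionLift.
Variable D : idomainType.

Lemma fraction_numden (f : {fraction D}) :
  exists n d, d != 0 /\ f = tofrac n / tofrac d.
Proof.
elim/quotW: f => -[[n d] /= d0]; exists n, d; split=> //.
have d0' : tofrac d != 0 by rewrite tofrac_eq0.
apply: (mulIf d0'); rewrite mulfVK // [LHS]/GRing.mul /= /FracField.tofrac.
unlock; rewrite -FracField.pi_mul; apply/eqmodP; rewrite /= FracField.equivfE.
rewrite /FracField.mulf /= !numden_Ratio ?oner_eq0 ?mulf_neq0 ?oner_eq0 //=.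
by rewrite !mulr1 mulrC.
Qed.

Variables (L : fieldType) (phi : {rmorphism D -> L}).

Let num (f : {fraction D}) := projT1 (cid (fraction_numden f)).
Let den (f : {fraction D}) := projT1 (cid (projT2 (cid (fraction_numden f)))).

(** The injectivity proof is an argument so that the morphism instances, which depend on it, can be
    attached to the function. The chosen numerator and denominator are immaterial: by
    [fraction_liftE] any representative gives the same value. *)
Definition fraction_lift of injective phi := fun f : {fraction D} =>
  phi (num f) / phi (den f).

Hypothesis phi_inj : injective phi.
Local Notation lift := (fraction_lift phi_inj).

Let phi_neq0 d : d != 0 -> phi d != 0.
Proof. by apply: contra_neq => pd; apply: phi_inj; rewrite pd rmorph0. Qed.

Lemma fraction_liftE n d : d != 0 ->
  lift (tofrac n / tofrac d) = phi n / phi d.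
Proof.
move=> d0; rewrite /fraction_lift; set f := tofrac n / _.
have [dn0 fE] := projT2 (cid (projT2 (cid (fraction_numden f)))).
rewrite -/(den f) -/(num f) in dn0 fE.
apply/eqP; rewrite eqr_div ?phi_neq0 // -!rmorphM; apply/eqP; congr (phi _).
apply/eqP; rewrite -tofrac_eq !tofracM -eqr_div ?tofrac_eq0 //; exact/eqP.
Qed.

Lemma fraction_lift_zmod_morphism : zmod_morphism lift.
Proof.
move=> f g; have [n [d [d0 ->]]] := fraction_numden f.
have [n' [d' [d'0 ->]]] := fraction_numden g.
rewrite -mulNr addf_div ?tofrac_eq0 // -tofracN -!tofracM -tofracD.
rewrite !fraction_liftE ?mulf_neq0 //.
by rewrite -mulNr addf_div ?phi_neq0 // rmorphD !rmorphM rmorphN.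
Qed.

Lemma fraction_lift_monoid_morphism : monoid_morphism lift.
Proof.
split=> [|f g].
  by rewrite -[1]divr1 -tofrac1 fraction_liftE ?oner_eq0 // rmorph1 divr1.
have [n [d [d0 ->]]] := fraction_numden f.
have [n' [d' [d'0 ->]]] := fraction_numden g.
rewrite mulf_div -!tofracM !fraction_liftE ?mulf_neq0 //.
by rewrite !rmorphM mulf_div.
Qed.

HB.instance Definition _ := GRing.isZmodMorphism.Build _ _ lift
  fraction_lift_zmod_morphism.
HB.instance Definition _ := GRing.isMonoidMorphism.Build _ _ lift
  fraction_lift_monoid_morphism.

Lemma fraction_lift_tofrac p : lift (tofrac p) = phi p.
Proof.
by rewrite -[tofrac p]divr1 -tofrac1 fraction_liftE ?oner_eq0 // rmorph1 divr1.
Qed.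

End FractionLift.

(** * Generated subalgebras: induction, morphisms and restriction *)

Section GeneratedSubalg.
Variables (K : fieldType) (V : comAlgType K).
Implicit Types (G : set V) (P : subalgClosed V).

Lemma mem_generated_subalg G g : G g -> g \in generated_subalg G.
Proof. by move=> Gg; apply/asboolP=> P _; apply. Qed.

Lemma generated_subalg_min G (P : {pred V}) : GRing.subalg_closed P ->
  (forall g, G g -> g \in P) -> {subset generated_subalg G <= P}.
Proof. by move=> Pc GP f /asboolP; apply. Qed.

Lemma subalgClosed_closed P : GRing.subalg_closed P.
Proof.
split; first exact: rpred1.
- by move=> c f g Pf Pg; rewrite rpredD ?rpredZ.
- by move=> f g Pf Pg; rewrite rpredM.
Qed.

Lemma generated_subalg_sub G P :
  (forall g, G g -> g \in P) -> {subset generated_subalg G <= P}.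
Proof. exact/generated_subalg_min/subalgClosed_closed. Qed.

Lemma generated_subalg_morph G P (Phi : {lrmorphism V -> V}) :
  (forall g, G g -> Phi g \in P) ->
  {in generated_subalg G, forall f, Phi f \in P}.
Proof.
move=> GP f; apply: (generated_subalg_min (P := [pred f | Phi f \in P])) => //.
split=> [|c g h|g h]; rewrite !inE ?rmorph1 ?rpred1 //.
- by move=> Pg Ph; rewrite linearP rpredD ?rpredZ.
- by move=> Pg Ph; rewrite rmorphM rpredM.
Qed.

(** The equalizer of two algebra morphisms is a subalgebra. [P] is only required to have the same
    elements as a generated subalgebra, so that the lemma also covers the upper cluster algebra,
    which is defined as an intersection. *)
Lemma lrmorphism_eq_on_generators G P (W : algType K)
    (phi psi : {lrmorphism subalg_type P -> W}) :
  {subset P <= generated_subalg G} ->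
  (forall g, G g -> g \in P) ->
  (forall a : subalg_type P, G (val a) -> phi a = psi a) -> phi =1 psi.
Proof.
move=> PG GP eqG a.
(* The equalizer, seen as a predicate on the ambient algebra [V], where induction on generated
   subalgebras takes place. *)
pose E : {pred V} := fun f =>
  `[< forall a : subalg_type P, val a = f -> phi a = psi a >] && (f \in P).
suff /andP[/asboolP/(_ a erefl) //] : val a \in E.
apply: generated_subalg_min (PG _ (valP a)); first split.
- apply/andP; split; last exact: rpred1; apply/asboolP=> b b1.
  by have -> : b = 1 by [apply: val_inj]; rewrite !rmorph1.
- move=> c f g /andP[/asboolP Ef Pf] /andP[/asboolP Eg Pg].
  apply/andP; split; last by rewrite rpredD ?rpredZ.
  apply/asboolP=> b bE.
  pose f' : subalg_type P := Sub f Pf; pose g' : subalg_type P := Sub g Pg.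
  have -> : b = c *: f' + g' by apply: val_inj; rewrite bE.
  by rewrite !linearP; congr (_ *: _ + _); [exact: Ef | exact: Eg].
- move=> f g /andP[/asboolP Ef Pf] /andP[/asboolP Eg Pg].
  apply/andP; split; last by rewrite rpredM.
  apply/asboolP=> b bE.
  pose f' : subalg_type P := Sub f Pf; pose g' : subalg_type P := Sub g Pg.
  have -> : b = f' * g' by apply: val_inj; rewrite bE.
  by rewrite !rmorphM; congr (_ * _); [exact: Ef | exact: Eg].
- move=> g Gg; apply/andP; split; last exact: GP.
  by apply/asboolP=> b bE; apply: eqG; rewrite bE.
Qed.

Section Restriction.
Variables (P : subalgClosed V) (Phi : {lrmorphism V -> V}).

Definition subalg_restr (PP : {in P, forall f, Phi f \in P})
  (a : subalg_type P) : subalg_type P := Sub (Phi (val a)) (PP _ (valP a)).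

Hypothesis PP : {in P, forall f, Phi f \in P}.
Local Notation restr := (subalg_restr PP).

Lemma val_subalg_restr a : val (restr a) = Phi (val a).
Proof. by []. Qed.

Lemma subalg_restr_involutive : involutive Phi -> involutive restr.
Proof. by move=> PhiK a; apply: val_inj; rewrite !val_subalg_restr PhiK. Qed.

Fact subalg_restr_zmod_morphism : zmod_morphism restr.
Proof. by move=> a b; apply: val_inj; rewrite /= rmorphB. Qed.

Fact subalg_restr_monoid_morphism : monoid_morphism restr.
Proof.
by split=> [|a b]; apply: val_inj; rewrite /= ?rmorph1 ?rmorphM.
Qed.

Fact subalg_restr_scalable : scalable restr.
Proof. by move=> c a; apply: val_inj; rewrite /= linearZ. Qed.

HB.instance Definition _ := GRing.isZmodMorphism.Build _ _ restr
  subalg_restr_zmod_morphism.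
HB.instance Definition _ := GRing.isMonoidMorphism.Build _ _ restr
  subalg_restr_monoid_morphism.
HB.instance Definition _ := GRing.isScalable.Build _ _ _ _ restr
  subalg_restr_scalable.

End Restriction.
End GeneratedSubalg.

(** * Sign changes of the variables of the rational function field *)

Lemma mpoly_rmorph_eq (K S : comNzRingType) N
    (phi psi : {rmorphism {mpoly K[N]} -> S}) :
  (forall c, phi c%:MP = psi c%:MP) -> (forall i, phi 'X_i = psi 'X_i) ->
  phi =1 psi.
Proof.
move=> eqC eqX p; rewrite (mpolyE p) !rmorph_sum; apply: eq_bigr => m _.
rewrite -mul_mpolyC !rmorphM eqC mpolyXE_id !rmorph_prod; congr (_ * _).
by apply: eq_bigr => i _; rewrite !rmorphXn eqX.
Qed.

Section SignChange.
Variables (K : fieldType) (N : nat) (b : 'I_N -> bool).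

Definition sign_poly (p : {mpoly K[N]}) : {mpoly K[N]} :=
  p \mPo [tuple (-1) ^+ b i *: 'X_i | i < N].

HB.instance Definition _ := GRing.LRMorphism.copy sign_poly
  (comp_mpoly [tuple (-1) ^+ b i *: 'X_i | i < N]).

Fact sign_polyX i : sign_poly 'X_i = (-1) ^+ b i *: 'X_i.
Proof. by rewrite /sign_poly comp_mpolyXU -tnth_nth tnth_mktuple. Qed.

Fact sign_polyC c : sign_poly c%:MP = c%:MP.
Proof. exact: comp_mpolyC. Qed.

Fact sign_polyK : involutive sign_poly.
Proof.
apply: (@mpoly_rmorph_eq _ _ _ (sign_poly \o sign_poly) idfun) => [c|i] /=.
  by rewrite !sign_polyC.
by rewrite sign_polyX linearZ /= sign_polyX scalerA -signr_addb addbb scale1r.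
Qed.

Definition ratfun_of_sign_poly : {mpoly K[N]} -> ratfun K N :=
  fun p => tofrac (sign_poly p).
HB.instance Definition _ := GRing.RMorphism.copy ratfun_of_sign_poly
  (@FracField.tofrac {mpoly K[N]} \o sign_poly).

Fact ratfun_of_sign_poly_inj : injective ratfun_of_sign_poly.
Proof.
by move=> p q /eqP; rewrite [_ == _]tofrac_eq => /eqP /(inv_inj sign_polyK).
Qed.

Definition ratfun_sign (f : ratfun K N) : ratfun K N :=
  fraction_lift ratfun_of_sign_poly_inj f.
Arguments ratfun_sign : simpl never.
HB.instance Definition _ := GRing.RMorphism.copy ratfun_sign
  (fraction_lift ratfun_of_sign_poly_inj).

Fact ratfun_sign_tofrac p : ratfun_sign (tofrac p) = tofrac (sign_poly p).
Proof. exact: fraction_lift_tofrac. Qed.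

Fact ratfun_sign_scalable : scalable ratfun_sign.
Proof.
move=> c f; rewrite -[c *: f]/(ratfun_const N c * f) rmorphM /=.
by rewrite ratfun_sign_tofrac sign_polyC.
Qed.
HB.instance Definition _ := GRing.isScalable.Build _ _ _ _ ratfun_sign
  ratfun_sign_scalable.

Lemma ratfun_sign_var i :
  ratfun_sign (ratfun_var K i) = (-1) ^+ b i *: ratfun_var K i.
Proof.
by rewrite ratfun_sign_tofrac sign_polyX -mul_mpolyC tofracM.
Qed.

Lemma ratfun_signK : involutive ratfun_sign.
Proof.
move=> f; have [n [d [d0 ->]]] := fraction_numden f.
have signV n' d' : ratfun_sign (tofrac n' / tofrac d')
    = tofrac (sign_poly n') / tofrac (sign_poly d').
  by rewrite fmorph_div; congr (_ / _); apply: ratfun_sign_tofrac.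
by rewrite !signV !sign_polyK.
Qed.

End SignChange.

(** * A quadratic extension of a polynomial ring *)

(* If [u] is transcendental over [C] and [M = (u^2 + P) / (q u)], then
   [C[M]] is a polynomial ring and [1, u] are independent over it: as a
   Laurent polynomial in [u], [M^N] has nonzero lowest term [(P / (q u))^N]
   and highest term [(u / q)^N]. *)
Section QuadraticIndependence.
Variables (C : idomainType) (L : fieldType) (E : {rmorphism {poly C} -> L}).
Variables (P q : C) (M : L).
Hypotheses (E_inj : injective E) (P0 : P != 0).
Hypothesis ME : M * E (q *: 'X) = E ('X^2 + P%:P).

(** The type [{poly C}] is used in two ways: its variable stands for [u] under [E], and for [M]
    under [poly_at]. *)
Definition poly_at (g : {poly C}) : L := (map_poly (E \o polyC) g).[M].

HB.instance Definition _ := GRing.RMorphism.copy poly_at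
  (horner_eval M \o map_poly (E \o polyC)).

Lemma poly_at_indep g h : poly_at g + poly_at h * E 'X = 0 -> g = 0 /\ h = 0.
Proof.
have [N] := ubnP (maxn (size g) (size h)).
elim: N g h => // N IH g h; rewrite ltnS geq_max => /andP[sg sh] eq0.
case: N => [|N] in IH sg sh *.
  by move: sg sh; rewrite !leqn0 !size_poly_eq0 => /eqP-> /eqP->.
pose A : {poly C} := 'X^2 + P%:P; pose B : {poly C} := q *: 'X.
(* The supposed relation multiplied by [(q u)^N], which turns each [M^j] into [A^j B^(N-j)] and so
   gives a polynomial in [u]. *)
pose Z := \sum_(j < N.+1) ((g`_j)%:P + (h`_j)%:P * 'X) * A ^+ j * B ^+ (N - j).
have at_coef (p : {poly C}) : (size p <= N.+1)%N ->
    poly_at p = \sum_(j < N.+1) E (p`_j)%:P * M ^+ j.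
  move=> sp; rewrite /poly_at (@horner_coef_wide _ N.+1).
    by apply: eq_bigr => j _; rewrite coef_map.
  by rewrite (leq_trans (size_poly _ _)).
have Z0 : Z = 0.
  apply: E_inj; rewrite rmorph0 rmorph_sum /=.
  rewrite -[RHS](mul0r (E B ^+ N)) -[in RHS]eq0 !at_coef // mulr_suml.
  rewrite -big_split /= mulr_suml; apply: eq_bigr => j _.
  rewrite !rmorphM !rmorphXn rmorphD rmorphM /= -/A -ME -/B.
  have -> : E B ^+ N = E B ^+ j * E B ^+ (N - j).
    by rewrite -exprD subnKC // -ltnS.
  by rewrite exprMn; ring.
have szA : size A = 3%N by rewrite size_XnaddC.
have mA : A \is monic.
  rewrite monicE lead_coefDl ?lead_coefXn // size_polyXn size_polyC.
  by case: eqP.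
(* At [u = 0] the factor [B] vanishes, so only the term [j = N] survives, with value [g_N P^N]. *)
have gN : g`_N = 0.
  have /eqP := congr1 (fun p : {poly C} => p.[0]) Z0.
  rewrite horner0 horner_sum (bigD1 ord_max) //= big1 ?addr0 => [|j jN].
    rewrite subnn expr0 mulr1 !hornerE expr0n add0r.
    by rewrite mulf_eq0 expf_eq0 (negbTE P0) andbF orbF => /eqP.
  rewrite hornerM horner_exp !hornerE.
  rewrite [0 ^+ (N - j)]expr0n subn_eq0.
  by rewrite leqNgt ltn_neqAle jN -ltnS ltn_ord mulr0.
have sA j : size (A ^+ j) = (2 * j).+1.
  have := size_exp A j; have : A ^+ j != 0 by rewrite monic_neq0 ?monic_exp.
  by rewrite szA -size_poly_gt0; lia.
have sB j : (size (B ^+ j) <= j.+1)%N.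
  by rewrite exprZn (leq_trans (size_scale_leq _ _)) ?size_polyXn.
(* The term of index [j] has degree at most [N + j + 1] in [u], so only [j = N] reaches degree
   [2N + 1]; there [A^N] is monic and the coefficient is [h_N]. *)
have hN : h`_N = 0.
  have /eqP := congr1 (fun p : {poly C} => p`_(2 * N).+1) Z0.
  rewrite coef0 coef_sum (bigD1 ord_max) //= big1 ?addr0 => [|j jN].
    rewrite subnn expr0 mulr1 mulrDl coefD -mulrA !coefCM coefXM /=.
    rewrite [_`_(_.+1)]nth_default ?sA // mulr0 add0r.
    have -> : (A ^+ N)`_(2 * N) = lead_coef (A ^+ N).
      by rewrite lead_coefE sA.
    by rewrite (monicP (monic_exp N mA)) mulr1 => /eqP.
  have jN' : (j < N)%N by rewrite ltn_neqAle jN -ltnS ltn_ord.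
  apply: nth_default; rewrite -mulrA.
  have s1 : (size ((g`_j)%:P + (h`_j)%:P * 'X)%R <= 2)%N.
    rewrite addrC -cons_poly_def size_cons_poly; case: ifP => // _.
    by rewrite ltnS size_polyC; case: eqP.
  have s2 : (size (A ^+ j * B ^+ (N - j))%R <= (2 * j).+1 + (N - j))%N.
    rewrite (leq_trans (size_polyMleq _ _)) // sA /= addSn /= -addnS.
    by rewrite leq_add2l sB.
  apply: leq_trans (size_polyMleq _ _) _.
  rewrite -subn1 leq_subLR (leq_trans (leq_add s1 s2)) //; lia.
have shrink (p : {poly C}) : (size p <= N.+1)%N -> p`_N = 0 -> (size p <= N)%N.
  move=> sp pN; rewrite leqNgt; apply/negP => sN.
  have sE : size p = N.+1 by apply/eqP; rewrite eqn_leq sp.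
  move/eqP: pN; rewrite -[N in p`_N]/(N.+1.-1) -sE -lead_coefE.
  by rewrite lead_coef_eq0 -size_poly_eq0 sE.
by apply: IH => //; rewrite ltnS geq_max !shrink.
Qed.

Lemma poly_atC c : poly_at c%:P = E c%:P.
Proof. by rewrite /poly_at map_polyC hornerC. Qed.

Lemma poly_atX : poly_at 'X = M.
Proof. by rewrite /poly_at map_polyX hornerX. Qed.

Definition quad_form (f : L) : Prop :=
  exists g h, f = poly_at g + poly_at h * E 'X.

(** The quadratic equation of [u] over [C[M]]; it makes [C[M] + C[M] u] closed under products. *)
Lemma quad_gen : E 'X ^+ 2 = M * poly_at q%:P * E 'X - poly_at P%:P.
Proof.
rewrite !poly_atC -mulrA -rmorphM /= mul_polyC ME rmorphD rmorphXn.
by rewrite addrK.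
Qed.

Lemma quad_form_base g : quad_form (poly_at g).
Proof. by exists g, 0; rewrite rmorph0 mul0r addr0. Qed.

Lemma quad_form_gen : quad_form (E 'X).
Proof. by exists 0, 1; rewrite rmorph0 rmorph1 mul1r add0r. Qed.

Lemma quad_formD f f' : quad_form f -> quad_form f' -> quad_form (f + f').
Proof.
move=> [g [h ->]] [g' [h' ->]]; exists (g + g'), (h + h').
by rewrite !rmorphD /=; ring.
Qed.

Lemma quad_formM f f' : quad_form f -> quad_form f' -> quad_form (f * f').
Proof.
move=> [g [h ->]] [g' [h' ->]].
exists (g * g' - h * h' * P%:P), (g * h' + h * g' + h * h' * 'X * q%:P).
rewrite !(rmorphD, rmorphN, rmorphM) /= poly_atX.
ring: quad_gen.
Qed.

(** Write [r = g + h u] and [s = g' + h' u]. By [quad_gen], [u s] has coordinates [- P h'] and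
    [g' + M q h']. Comparing with [b r], [b] divides [P h'], hence [h'] by the assumption on [P],
    hence also [g']. *)
Lemma quad_form_regular b r s : b != 0 ->
  (forall h c, h * P%:P = b * c -> exists h', h = b * h') ->
  quad_form r -> quad_form s -> poly_at b * r = E 'X * s ->
  exists2 t, quad_form t & s = poly_at b * t.
Proof.
move=> b0 bP [g [h ->]] [g' [h' ->]] eq_rs.
have [] := @poly_at_indep (b * g + h' * P%:P) (b * h - g' - h' * 'X * q%:P).
  rewrite !(rmorphD, rmorphN, rmorphM) /= poly_atX.
  transitivity (poly_at b * (poly_at g + poly_at h * E 'X)
    - E 'X * (poly_at g' + poly_at h' * E 'X)
    + poly_at h' * (E 'X ^+ 2 - (M * poly_at q%:P * E 'X - poly_at P%:P))).
    by ring.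
  by rewrite eq_rs quad_gen !subrr mulr0 addr0.
move=> /eqP; rewrite addrC addr_eq0 -mulrN => /eqP /bP[h'' ->].
rewrite -addrA -opprD => /eqP; rewrite subr_eq0 => /eqP eqh.
exists (poly_at (h - h'' * 'X * q%:P) + poly_at h'' * E 'X).
  by exists (h - h'' * 'X * q%:P), h''.
have -> : g' = b * (h - h'' * 'X * q%:P).
  by rewrite mulrBr eqh; ring.
by rewrite !rmorphM mulrDr mulrA.
Qed.

End QuadraticIndependence.

(** * Polynomials in three variables as iterated univariate polynomials *)

Section IteratedPolynomials.
Variables (K : fieldType) (A : comAlgType K).

Definition poly2_at (v w : A) (p : {poly {poly K}}) : A :=
  (map_poly (horner_alg w) p).[v].
HB.instance Definition _ v w := GRing.RMorphism.copy (poly2_at v w)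
  (horner_eval v \o map_poly (horner_alg w)).

Definition poly3_at (u v w : A) (p : {poly {poly {poly K}}}) : A :=
  (map_poly (poly2_at v w) p).[u].
HB.instance Definition _ u v w := GRing.RMorphism.copy (poly3_at u v w)
  (horner_eval u \o map_poly (poly2_at v w)).

Lemma poly2_atC v w p : poly2_at v w p%:P = horner_alg w p.
Proof. by rewrite /poly2_at map_polyC hornerC. Qed.

Lemma poly2_atX v w : poly2_at v w 'X = v.
Proof. by rewrite /poly2_at map_polyX hornerX. Qed.

Lemma poly3_atC u v w p : poly3_at u v w p%:P = poly2_at v w p.
Proof. by rewrite /poly3_at map_polyC hornerC. Qed.

Lemma poly3_atX u v w : poly3_at u v w 'X = u.
Proof. by rewrite /poly3_at map_polyX hornerX. Qed.

End IteratedPolynomials.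

Lemma poly_rmorph_surj (C S A : nzRingType) (f : {rmorphism S -> A})
    (g : {rmorphism {poly C} -> A}) :
  (forall c, exists s, f s = g c%:P) -> (exists s, f s = g 'X) ->
  forall p, exists s, f s = g p.
Proof.
move=> fC [sX fX]; elim/poly_ind => [|p c [s fs]].
  by exists 0; rewrite !rmorph0.
have [t ft] := fC c; exists (s * sX + t).
by rewrite !rmorphD !rmorphM; congr (_ * _ + _).
Qed.

Lemma ord3_third (i j l k : 'I_3) : i != j -> i != l -> j != l ->
  k != i -> k != j -> k = l.
Proof.
rewrite -!val_eqE => ij il jl ki kj; apply: val_inj.
move: ij il jl ki kj (ltn_ord i) (ltn_ord j) (ltn_ord k) (ltn_ord l) => /=.
by lia.
Qed.

Section RatfunPolynomials.
Variables (K : fieldType) (i j l : 'I_3).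
Hypotheses (ij : i != j) (il : i != l) (jl : j != l).
Local Notation x := (@ratfun_var K 3).

Let onvar (k : 'I_3) : {poly {poly {poly K}}} :=
  if k == i then 'X else if k == j then 'X%:P else 'X%:P%:P.

Let iter : {rmorphism {mpoly K[3]} -> {poly {poly {poly K}}}} :=
  mmap (polyC \o polyC \o polyC) onvar.

Lemma ratfun_constE (N : nat) (c : K) : ratfun_const N c = c%:A.
Proof. by rewrite -[RHS]/(ratfun_const N c * 1) mulr1. Qed.

(** Composed with the surjection [iter] from [{mpoly K[3]}], the evaluation becomes the embedding of
    polynomials into fractions, which is injective. *)
Lemma poly3_at_var_inj : injective (poly3_at (x i) (x j) (x l)).
Proof.
have evE : poly3_at (x i) (x j) (x l) \o iter
    =1 @FracField.tofrac {mpoly K[3]}.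
  apply: mpoly_rmorph_eq => [c|k] /=.
    by rewrite mmapC /= poly3_atC poly2_atC horner_algC -ratfun_constE.
  rewrite mmapX mmap1U /onvar.
  have [->|ki] := eqVneq k i; first by rewrite poly3_atX.
  have [->|kj] := eqVneq k j; first by rewrite poly3_atC poly2_atX.
  have -> : k = l by apply: ord3_third ki kj.
  by rewrite poly3_atC poly2_atC horner_algX.
have surj1 (p : {poly K}) : exists s, iter s = p%:P%:P.
  apply: (@poly_rmorph_surj _ _ _ iter (polyC \o polyC)) => [c|].
    by exists c%:MP; rewrite /= mmapC.
  exists 'X_l; rewrite /= mmapX mmap1U /onvar.
  by rewrite [l == i]eq_sym [l == j]eq_sym (negbTE il) (negbTE jl).
have surj2 (p : {poly {poly K}}) : exists s, iter s = p%:P.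
  apply: (@poly_rmorph_surj _ _ _ iter polyC) => [|].
    exact: surj1.
  by exists 'X_j; rewrite /= mmapX mmap1U /onvar eq_sym (negbTE ij) eqxx.
have surj p : exists s, iter s = p.
  apply: (@poly_rmorph_surj _ _ _ iter idfun) => [|].
    exact: surj2.
  by exists 'X_i; rewrite /= mmapX mmap1U /onvar eqxx.
move=> p q; have [s <-] := surj p; have [t <-] := surj q.
rewrite -[LHS]/((_ \o _) s) -[RHS]/((_ \o _) t) !evE => /eqP.
by rewrite tofrac_eq => /eqP ->.
Qed.

End RatfunPolynomials.

Lemma big_ord3 (R : Type) (idx : R) (op : Monoid.com_law idx) (F : 'I_3 -> R)
    (i j l : 'I_3) : i != j -> i != l -> j != l ->
  \big[op/idx]_k F k = op (F i) (op (F j) (F l)).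
Proof.
move=> ij il jl; rewrite (bigD1 i) //= (bigD1 j) 1?eq_sym //=.
rewrite (bigD1 l) ?[l == i]eq_sym ?[l == j]eq_sym ?il ?jl //= big1.
  by rewrite Monoid.mulm1.
by move=> k /andP[/andP[ki kj]]; rewrite (ord3_third ij il jl ki kj) eqxx.
Qed.

Lemma poly_rmorph_mem (C A : nzRingType) (S : subringClosed A)
    (f : {rmorphism {poly C} -> A}) :
  (forall c, f c%:P \in S) -> f 'X \in S -> forall p, f p \in S.
Proof.
move=> fC fX; elim/poly_ind => [|p c Sp]; first by rewrite rmorph0 rpred0.
by rewrite rmorphD rmorphM rpredD ?rpredM.
Qed.

Lemma poly_divX (C : nzRingType) (p : {poly C}) :
  p.[0] = 0 -> p = 'X * drop_poly 1 p.
Proof.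
rewrite horner_coef0 => p0; rewrite -{1}[p](poly_take_drop 1) commr_polyX.
rewrite [take_poly 1 p](_ : _ = 0) ?add0r //.
by apply/polyP => -[|k]; rewrite coef_take_poly coef0 /= ?p0.
Qed.

(** * The ring [R = K[x_1, x_2, x_3, M]] and its normal form *)

Section MarkovRing.
Variable K : fieldType.
Local Notation F := (ratfun K 3).
Local Notation x := (@ratfun_var K 3).

Definition markov_elt : F := (\sum_i x i ^+ 2) / \prod_i x i.
Local Notation M := markov_elt.

Definition markov_ring : {pred F} :=
  generated_subalg (fun f : F => f = M \/ exists i, f = x i).
HB.instance Definition _ := GRing.SubalgClosed.on markov_ring.

Lemma markov_ring_elt : M \in markov_ring.
Proof. by apply: mem_generated_subalg; left. Qed.

Lemma markov_ring_var i : x i \in markov_ring.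
Proof. by apply: mem_generated_subalg; right; exists i. Qed.

Lemma ratfun_var_neq0 i : x i != 0.
Proof.
rewrite tofrac_eq0; apply/eqP => /(congr1 (meval (fun=> 1))) /eqP.
by rewrite mevalXU meval0 oner_eq0.
Qed.

(* For [a != 0], multiplication by [b] is injective on [R / aR]. *)
Definition regular_pair (a b : F) : Prop :=
  {in markov_ring &, forall r s, b * r = a * s ->
     exists2 t, t \in markov_ring & s = b * t}.

Section NormalForm.
Variables i j l : 'I_3.
Hypotheses (ij : i != j) (il : i != l) (jl : j != l).
Let E : {rmorphism {poly {poly {poly K}}} -> F} := poly3_at (x i) (x j) (x l).
Local Notation NF := (@quad_form {poly {poly K}} F E M).
Local Notation at_M := (@poly_at {poly {poly K}} F E M).

Let E_X : E 'X = x i. Proof. exact: poly3_atX. Qed.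
Let E_CX : E 'X%:P = x j. Proof. by rewrite [LHS]poly3_atC poly2_atX. Qed.
Let E_CCX : E 'X%:P%:P = x l.
Proof. by rewrite [LHS]poly3_atC poly2_atC horner_algX. Qed.
Let E_CCC c : E c%:P%:P%:P = c%:A.
Proof. by rewrite [LHS]poly3_atC poly2_atC horner_algC. Qed.
(** The quadratic extension is used with [u = x_i] over [C = K[x_l][x_j]]: here [q] stands for
    [x_j x_l] and [P] for [x_j^2 + x_l^2]. *)
Let q : {poly {poly K}} := 'X * 'X%:P.
Let P : {poly {poly K}} := 'X ^+ 2 + 'X%:P ^+ 2.

Let markov_eltE : M * E (q *: 'X) = E ('X^2 + P%:P).
Proof.
rewrite /M (big_ord3 _ _ ij il jl) (big_ord3 _ _ ij il jl) /=.
rewrite -mul_polyC /q /P !(polyCM, polyCD, polyC_exp).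
rewrite !(rmorphD, rmorphM, rmorphXn) /= E_X E_CX E_CCX.
by rewrite [in X in _ / X]mulrC mulfVK ?mulf_neq0 ?ratfun_var_neq0.
Qed.

Let P_neq0 : P != 0.
Proof.
apply/eqP => /(congr1 (fun p : {poly _} => p`_2)).
by rewrite coefD coefXn -rmorphXn coefC coef0 addr0 => /eqP; rewrite oner_eq0.
Qed.

Let E_inj : injective E. Proof. exact: poly3_at_var_inj. Qed.

(** [C[M] + C[M] x_i] is a subalgebra containing all generators of [R]. Together with the converse
    inclusion below and [poly_at_indep], this makes [R] free over [C[M]] with basis [1, x_i]. *)
Lemma markov_ring_quad_form f : f \in markov_ring -> NF f.
Proof.
pose NFp : {pred F} := fun f => `[< NF f >].
suff sub : {subset markov_ring <= NFp} by move/sub/asboolP.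
have NFC c : NF (c%:A : F).
  have -> : c%:A = at_M c%:P%:P%:P by rewrite poly_atC E_CCC.
  exact: quad_form_base.
have [NFD NFM] := (@quad_formD _ _ E M, quad_formM markov_eltE).
apply: generated_subalg_min => [|g [->|[k ->]]]; last 2 first.
- by apply/asboolP; rewrite -{2}[M](poly_atX E); apply: quad_form_base.
- apply/asboolP; have [->|ki] := eqVneq k i.
    by rewrite -E_X; apply: quad_form_gen.
  have [->|kj] := eqVneq k j.
    have -> : x j = at_M 'X%:P by rewrite poly_atC E_CX.
    exact: quad_form_base.
  have -> : x k = at_M 'X%:P%:P.
    by rewrite poly_atC E_CCX (ord3_third ij il jl ki kj).
  exact: quad_form_base.
split.
- by apply/asboolP; rewrite -(scale1r 1); apply: NFC.
- move=> c f' g /asboolP NFf /asboolP NFg; apply/asboolP.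
  by apply: NFD => //; rewrite -mulr_algl; apply: NFM.
- by move=> f' g /asboolP NFf /asboolP NFg; apply/asboolP; apply: NFM.
Qed.

Lemma quad_form_markov_ring f : NF f -> f \in markov_ring.
Proof.
have mem1 (p : {poly K}) : E p%:P%:P \in markov_ring.
  apply: (@poly_rmorph_mem _ _ markov_ring (E \o polyC \o polyC)) => [c|] /=.
    by rewrite E_CCC rpredZ ?rpred1.
  by rewrite /= E_CCX markov_ring_var.
have mem2 (p : {poly {poly K}}) : E p%:P \in markov_ring.
  apply: (@poly_rmorph_mem _ _ markov_ring (E \o polyC)) => [|].
    exact: mem1.
  by rewrite /= E_CX markov_ring_var.
have memM p : at_M p \in markov_ring.
  apply: (@poly_rmorph_mem _ _ markov_ring at_M) => [c|].
    by rewrite /= poly_atC.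
  by rewrite /= poly_atX markov_ring_elt.
by move=> [g [h ->]]; rewrite rpredD ?rpredM ?memM // E_X markov_ring_var.
Qed.

(** [P] is nonzero and free of [M], so if [M] divides [h P], the constant term of [h] in [M] is
    zero. *)
Lemma regular_pair_var_elt : regular_pair (x i) M.
Proof.
move=> r s Rr Rs; rewrite -{1}[M](poly_atX E) -{1}E_X => eq_rs.
have [||||t Rt sE] := quad_form_regular E_inj
    P_neq0 markov_eltE _ _ _ _ eq_rs; try exact: markov_ring_quad_form.
- by rewrite polyX_eq0.
- move=> h c hP; exists (drop_poly 1 h); apply: poly_divX.
  apply: (mulIf P_neq0).
  by have := congr1 (horner^~ 0) hP; rewrite !hornerM hornerC hornerX !mul0r.
- by exists t; [apply: quad_form_markov_ring | rewrite sE poly_atX].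
Qed.

(** Modulo [x_j], [P] becomes [x_l^2], which is not a zero divisor; hence if [x_j] divides [h P], it
    divides every coefficient of [h] as a polynomial in [M]. *)
Lemma regular_pair_var_var : regular_pair (x i) (x j).
Proof.
have xjE : x j = at_M 'X%:P by rewrite poly_atC E_CX.
move=> r s Rr Rs; rewrite {1}xjE -{1}E_X => eq_rs.
have [||||t Rt sE] := quad_form_regular E_inj
    P_neq0 markov_eltE _ _ _ _ eq_rs; try exact: markov_ring_quad_form.
- by rewrite polyC_eq0 polyX_eq0.
- move=> h c hP; have hk k : h`_k = 'X * drop_poly 1 h`_k.
    apply: poly_divX; have P00 : P.[0] != 0.
      by rewrite !hornerE expr0n add0r expf_eq0 polyX_eq0.
    apply: (mulIf P00); rewrite -hornerM mul0r -coefMC hP coefCM.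
    by rewrite hornerM hornerX mul0r.
  (* The quotient by [x_j], taken coefficient by coefficient. *)
  exists (\poly_(k < size h) drop_poly 1 h`_k); apply/polyP => k.
  rewrite coefCM coef_poly; case: ltnP => [_|/(nth_default 0) ->] //.
  by rewrite mulr0.
- by exists t; [apply: quad_form_markov_ring | rewrite sE xjE].
Qed.

End NormalForm.
End MarkovRing.

Lemma ord3_other (i j : 'I_3) : i != j -> exists2 l, i != l & j != l.
Proof.
move=> ij; have [l] : exists l, l \in ~: [set i; j].
  by apply/set0Pn; rewrite -card_gt0 cardsCs finset.setCK card_ord cards2 ij.
by rewrite !inE negb_or => /andP[li lj]; exists l; rewrite eq_sym.
Qed.

Lemma ord3_avoid (i j : 'I_3) : exists2 l, i != l & j != l.
Proof.
have [->|/ord3_other//] := eqVneq i j.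
by have [->|j0] := eqVneq j ord0; [exists ord_max | exists ord0].
Qed.

(** * Calculus of regular pairs and removal of denominators *)

Section RegularPairs.
Variable K : fieldType.
Local Notation F := (ratfun K 3).
Local Notation x := (@ratfun_var K 3).
Local Notation M := (markov_elt K).
Local Notation R := (@markov_ring K).

Lemma regular_pairM (a b c : F) : b != 0 -> c \in R ->
  regular_pair a b -> regular_pair a c -> regular_pair a (b * c).
Proof.
move=> b0 Rc ab ac r s Rr Rs; rewrite -mulrA => eq_rs.
have [t Rt sE] := ab _ _ (rpredM Rc Rr) Rs eq_rs.
have [|t' Rt' tE] := ac r t Rr Rt.
  by apply: (mulfI b0); rewrite eq_rs sE mulrCA.
by exists t'; rewrite // sE tE mulrA.
Qed.

Lemma regular_pairX (a b : F) n : b != 0 -> b \in R ->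
  regular_pair a b -> regular_pair a (b ^+ n).
Proof.
move=> b0 Rb ab; elim: n => [|n IH].
  by move=> r s _ Rs _; exists s; rewrite ?mul1r.
by rewrite exprS; apply: regular_pairM => //; rewrite rpredX.
Qed.

(** [b] and [b - a] agree modulo [a]. *)
Lemma regular_pair_sub (a b : F) :
  b != 0 -> regular_pair a b -> regular_pair a (b - a).
Proof.
move=> b0 ab r s Rr Rs; rewrite mulrBl => /eqP; rewrite subr_eq -mulrDr => /eqP.
move=> eq_rs; have [t Rt srE] := ab _ _ Rr (rpredD Rs Rr) eq_rs.
exists t => //; rewrite mulrBl -srE (_ : a * t = r) ?addrK //.
by apply: (mulfI b0); rewrite eq_rs srE mulrCA.
Qed.

(** Powers of [a] are removed one at a time: [b^m (a^(n+1) f) = a (a^n b^m f)], so regularity makes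
    [a^n b^m f] a multiple of [b^m] in [R], that is, [a^n f] lies in [R]. *)
Lemma regular_pair_denominators (a b f : F) n m : b != 0 ->
  a \in R -> b \in R -> regular_pair a b ->
  a ^+ n * f \in R -> b ^+ m * f \in R -> f \in R.
Proof.
move=> b0 Ra Rb ab + Rbf; elim: n => [|n IH]; first by rewrite mul1r.
move=> Raf; apply: IH.
have [|t Rt] := regular_pairX (n := m) b0 Rb ab Raf (rpredM (rpredX n Ra) Rbf).
  by rewrite exprS -!mulrA mulrCA; congr (_ * _); rewrite mulrCA.
by rewrite mulrCA => /(mulfI (expf_neq0 m b0)) ->.
Qed.

Lemma markov_elt_neq0 : M != 0.
Proof.
rewrite mulf_neq0 ?invr_eq0 //; last first.
  by rewrite prodf_seq_neq0; apply/allP => k _; rewrite ratfun_var_neq0.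
have -> : \sum_i x i ^+ 2 = tofrac (\sum_i 'X_i ^+ 2).
  by rewrite rmorph_sum; apply: eq_bigr => k _; rewrite rmorphXn.
(* At [(1, 0, 0)] the sum of squares is 1 in every characteristic, whereas at [(1, 1, 1)] it could
   vanish. *)
rewrite tofrac_eq0; apply/eqP => /(congr1 (meval (fun k => (k == ord0)%:R))).
rewrite rmorph_sum rmorph0 (bigD1 ord0) //= big1 => [|k k0].
  by move/eqP; rewrite rmorphXn /= mevalXU eqxx expr1n addr0 oner_eq0.
by rewrite rmorphXn /= mevalXU (negbTE k0) expr0n.
Qed.

Lemma regular_pair_vars i j : i != j -> regular_pair (x i) (x j).
Proof.
move=> ij; have [l il jl] := ord3_other ij.
exact: (regular_pair_var_var ij il jl).
Qed.

(** The second entry is the mutated variable [x_i']; modulo [x_i] it is the product [x_j x_l M],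
    each factor of which is regular. *)
Lemma regular_pair_mutation i j l : i != j -> i != l -> j != l ->
  regular_pair (x i) (x j * x l * M - x i).
Proof.
move=> ij il jl; have x0 k : x k != 0 := ratfun_var_neq0 K k.
have xjl0 := mulf_neq0 (x0 j) (x0 l).
apply: (regular_pair_sub (mulf_neq0 xjl0 markov_elt_neq0)).
have iM : regular_pair (x i) M := regular_pair_var_elt ij il jl.
apply: (regular_pairM xjl0 (markov_ring_elt K) _ iM).
by apply: (regular_pairM (x0 j) (markov_ring_var K l));
  apply: regular_pair_vars.
Qed.

End RegularPairs.

(** * Seeds of the Markov quiver, exchange relations and the Markov equation *)

Lemma mutate_markov (k : 'I_3) : mutate_mx k markov_mx = - markov_mx.
Proof.
apply/matrixP => i j.
by case: k i j => [[|[|[|//]]] ?] [[|[|[|//]]] ?] [[|[|[|//]]] ?]; rewrite !mxE.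
Qed.

Lemma mutate_opp_markov (k : 'I_3) : mutate_mx k (- markov_mx) = markov_mx.
Proof.
apply/matrixP => i j.
by case: k i j => [[|[|[|//]]] ?] [[|[|[|//]]] ?] [[|[|[|//]]] ?]; rewrite !mxE.
Qed.

(** Vieta jumping: [z] and [z'] are the two roots of [T^2 - m Q T + S], whose product is [S]. *)
Lemma exchange_step (L : fieldType) (m z z' S Q : L) :
  z ^+ 2 + S = m * (z * Q) -> z' * z = S -> z != 0 ->
  z' ^+ 2 + S = m * (z' * Q).
Proof.
move=> + eqS; rewrite -eqS => markov z0; apply: (mulIf z0).
have -> : m * (z' * Q) * z = z' * (m * (z * Q)) by ring.
by rewrite -markov; ring.
Qed.

Section MarkovSeeds.
Variable K : numFieldType.
Local Notation F := (ratfun K 3).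
Local Notation x := (@ratfun_var K 3).
Local Notation M := (markov_elt K).
Local Notation reach := (@reachable K 3 0 markov_mx).
Implicit Types s : seed K 3 0.

(* The type ['I_3] is convertible to the index type ['I_(3 + 0)] of seeds. *)
Definition cluster s : 'I_3 -> F := seed_var s.

Lemma lshift0E (k : 'I_3) : lshift 0 k = k :> 'I_3.
Proof. exact: val_inj. Qed.

Lemma reachable_mx s : reach s ->
  seed_mx s = markov_mx \/ seed_mx s = - markov_mx.
Proof.
elim=> [|k s' _ [] /= ->]; first by left.
  by right; apply: mutate_markov.
by left; apply: mutate_opp_markov.
Qed.

Lemma cluster_mutate k s i : reach s -> cluster (mutate k s) i =
  if i == k then (cluster s k)^-1 * \sum_(j | j != k) cluster s j ^+ 2
  else cluster s i.
Proof.
move=> /reachable_mx Bs; rewrite /cluster /mutate /=.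
rewrite (_ : (i == _ :> 'I_(3 + 0)) = (i == k)); last by rewrite -!val_eqE.
case: (eqVneq i k) => [->|//]; congr (_ * _).
move: Bs; move: (seed_var s : 'I_3 -> F) (seed_mx s) => z B Bs.
rewrite !(big_mkcond _ (fun j => z j ^ _)) (big_mkcond (fun j => j != k)).
(* For either sign of the matrix the two exchange monomials are the squares of the two other
   variables; the sign only affects their order. *)
case: Bs => ->; case: k => [[|[|[|//]]] ?];
  rewrite !big_ord_recl !big_ord0 !mxE /=;
  by rewrite !(mul1r, mulr1, add0r, addr0, opprK) // addrC.
Qed.

Lemma cluster_mutate_same k s : reach s ->
  cluster (mutate k s) k
    = (cluster s k)^-1 * \sum_(j | j != k) cluster s j ^+ 2.
Proof. by move=> rs; rewrite cluster_mutate // eqxx. Qed.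

Lemma cluster_mutate_other k s i : reach s -> i != k ->
  cluster (mutate k s) i = cluster s i.
Proof. by move=> rs /negbTE ik; rewrite cluster_mutate // ik. Qed.

(* Mutation is subtraction-free, so positivity of the value at (1, 1, 1) is
   preserved; this is why no cluster variable is zero. *)
Definition pos_at1 (f : F) : Prop := exists n d : {mpoly K[3]},
  [/\ 0 < n.@[fun=> 1], 0 < d.@[fun=> 1] & f = tofrac n / tofrac d].

Let meval_neq0 (d : {mpoly K[3]}) : 0 < d.@[fun=> 1] -> tofrac d != 0.
Proof.
move=> d0; rewrite tofrac_eq0; apply: contraTneq d0 => ->.
by rewrite meval0 ltxx.
Qed.

Lemma pos_at1_neq0 f : pos_at1 f -> f != 0.
Proof.
by case=> n [d [n0 d0 ->]]; rewrite mulf_neq0 ?invr_eq0 ?meval_neq0.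
Qed.

Lemma pos_at1M f g : pos_at1 f -> pos_at1 g -> pos_at1 (f * g).
Proof.
move=> [n [d [n0 d0 ->]]] [n' [d' [n'0 d'0 ->]]].
exists (n * n'), (d * d'); rewrite !mevalM !mulr_gt0 //; split=> //.
by rewrite !tofracM mulf_div.
Qed.

Lemma pos_at1D f g : pos_at1 f -> pos_at1 g -> pos_at1 (f + g).
Proof.
move=> [n [d [n0 d0 ->]]] [n' [d' [n'0 d'0 ->]]].
exists (n * d' + n' * d), (d * d').
rewrite mevalD !mevalM addr_gt0 ?mulr_gt0 //; split=> //.
by rewrite tofracD !tofracM addf_div ?meval_neq0.
Qed.

Lemma pos_at1V f : pos_at1 f -> pos_at1 f^-1.
Proof.
by move=> [n [d [n0 d0 ->]]]; exists d, n; rewrite invf_div.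
Qed.

Lemma pos_at1_var i : pos_at1 (x i).
Proof.
by exists 'X_i, 1; rewrite mevalXU meval1 ltr01 tofrac1 divr1.
Qed.

Lemma cluster_pos s i : reach s -> pos_at1 (cluster s i).
Proof.
move=> rs; elim: rs i => [|k s' rs' IH] i; first exact: pos_at1_var.
have [->|ik] := eqVneq i k; last by rewrite cluster_mutate_other.
rewrite cluster_mutate_same //; apply/pos_at1M; first exact/pos_at1V.
have [j kj _] := ord3_avoid k k; have [l kl jl] := ord3_other kj.
rewrite big_mkcond (big_ord3 _ _ kj kl jl) eqxx /=.
rewrite [j == k]eq_sym [l == k]eq_sym (negbTE kj) (negbTE kl) /= add0r.
by apply: pos_at1D; apply: pos_at1M.
Qed.

Lemma cluster_neq0 s i : reach s -> cluster s i != 0.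
Proof. by move=> rs; apply/pos_at1_neq0/cluster_pos. Qed.

Lemma cluster_exchange k s : reach s ->
  cluster (mutate k s) k * cluster s k = \sum_(j | j != k) cluster s j ^+ 2.
Proof.
move=> rs; rewrite cluster_mutate_same // mulrC mulrA.
by rewrite divff ?mul1r ?cluster_neq0.
Qed.

Lemma markov_equation s : reach s ->
  \sum_i cluster s i ^+ 2 = M * \prod_i cluster s i.
Proof.
elim=> [|k s' rs' IH].
  rewrite /markov_elt mulfVK //.
  by rewrite prodf_seq_neq0; apply/allP => k _; rewrite ratfun_var_neq0.
move: IH (cluster_exchange k rs') (cluster_neq0 k rs').
have sumD (f : 'I_3 -> F) : \sum_i f i = f k + \sum_(i | i != k) f i.
  exact: bigD1.
have prodD (f : 'I_3 -> F) : \prod_i f i = f k * \prod_(i | i != k) f i.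
  exact: bigD1.
rewrite !sumD !prodD.
have -> : \sum_(i | i != k) cluster (mutate k s') i ^+ 2
    = \sum_(i | i != k) cluster s' i ^+ 2.
  by apply: eq_bigr => i ik; rewrite cluster_mutate_other.
have -> : \prod_(i | i != k) cluster (mutate k s') i
    = \prod_(i | i != k) cluster s' i.
  by apply: eq_bigr => i ik; rewrite cluster_mutate_other.
exact: exchange_step.
Qed.

(** The sum of the two roots in Vieta jumping: the Markov equation divided by [z_k]. *)
Lemma cluster_mutate_sum k s : reach s ->
  cluster s k + cluster (mutate k s) k = M * \prod_(j | j != k) cluster s j.
Proof.
move=> rs; have zk0 := cluster_neq0 k rs; apply: (mulIf zk0).
rewrite mulrDl cluster_exchange // -expr2.
have := markov_equation rs; rewrite (bigD1 k) //= => ->.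
by rewrite (bigD1 k) //= [cluster s k * _]mulrC mulrA.
Qed.

End MarkovSeeds.

(** * The upper cluster algebra is [R] *)

Section MarkovUpper.
Variable K : numFieldType.
Local Notation F := (ratfun K 3).
Local Notation x := (@ratfun_var K 3).
Local Notation M := (markov_elt K).
Local Notation R := (@markov_ring K).
Local Notation reach := (@reachable K 3 0 markov_mx).
Implicit Types s : seed K 3 0.

Lemma cluster_markov_ring s i : reach s -> cluster s i \in R.
Proof.
move=> rs; elim: rs i => [|k s' rs' IH] i; first exact: markov_ring_var.
have [->|ik] := eqVneq i k; last by rewrite cluster_mutate_other.
have -> : cluster (mutate k s') k
    = M * (\prod_(j | j != k) cluster s' j) - cluster s' k.
  by rewrite -cluster_mutate_sum // [_ + cluster (mutate _ _) _]addrC addrK.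
by rewrite rpredB // rpredM ?markov_ring_elt ?rpred_prod.
Qed.

(** By [cluster_mutate_sum] each mutation expresses the old variable through [M] and the new
    cluster, so [R] lies in the algebra generated by [M] and any cluster; the Markov equation writes
    [M] as a Laurent polynomial in that cluster. *)
Lemma markov_ring_laurent s : reach s -> {subset R <= laurent_ring s}.
Proof.
pose Rs s : subalgClosed F := @generated_subalg _ F
  (fun f : F => f = M \/ exists i, f = cluster s i).
have RsM s' : M \in Rs s' by apply: mem_generated_subalg; left.
have Rsv s' i : cluster s' i \in Rs s'.
  by apply: mem_generated_subalg; right; exists i.
have RRs s' : reach s' -> {subset R <= Rs s'}.
  elim=> [//|k s'' rs IH] f /IH; move: f; apply: generated_subalg_sub.
  move=> _ [->|[i ->]]; first exact: RsM.
  have [->|ik] := eqVneq i k; last by rewrite -(cluster_mutate_other rs ik).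
  have -> : cluster s'' k = M * (\prod_(j | j != k) cluster s'' j)
      - cluster (mutate k s'') k by rewrite -cluster_mutate_sum // addrK.
  apply: rpredB; last exact: Rsv; apply: rpredM; first exact: RsM.
  by apply: rpred_prod => j jk; rewrite -(cluster_mutate_other rs jk) Rsv.
move=> rs f /(RRs _ rs); move: f; apply: generated_subalg_sub.
have Lz i : cluster s i \in laurent_ring s.
  by apply: mem_generated_subalg; exists i; left.
have LzV i : (cluster s i)^-1 \in laurent_ring s.
  by apply: mem_generated_subalg; exists i; right.
move=> _ [->|[i ->]]; last exact: Lz.
have -> : M = (\sum_i cluster s i ^+ 2) * \prod_i (cluster s i)^-1.
  rewrite markov_equation // prodfV mulfK //.
  by rewrite prodf_seq_neq0; apply/allP => i _; rewrite cluster_neq0.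
rewrite /laurent_ring rpredM ?rpred_sum ?rpred_prod // => i _.
by rewrite rpredX // Lz.
Qed.

Lemma laurent_denominator s f : reach s -> f \in laurent_ring s ->
  exists n, (\prod_i cluster s i) ^+ n * f \in R.
Proof.
move=> rs; pose D := \prod_i cluster s i.
pose P : {pred F} := fun f => `[< exists n, D ^+ n * f \in R >].
have RD n : D ^+ n \in R.
  by rewrite rpredX // rpred_prod // => i _; apply: cluster_markov_ring.
suff sub : {subset laurent_ring s <= P} by move/sub/asboolP.
apply: generated_subalg_min => [|_ [i [->|->]]]; last 2 first.
- by apply/asboolP; exists 0; rewrite mul1r; apply: (cluster_markov_ring i).
- apply/asboolP; exists 1; rewrite expr1 /D (bigD1 (i : 'I_3)) //= mulrC mulKf.
    by rewrite rpred_prod // => j _; apply: cluster_markov_ring.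
  exact: (cluster_neq0 i).
split.
- by apply/asboolP; exists 0; rewrite mul1r rpred1.
- move=> c f' g /asboolP[n Rf] /asboolP[m Rg]; apply/asboolP.
  exists (n + m)%N; rewrite mulrDr -scalerAr rpredD ?rpredZ //.
    by rewrite exprD mulrAC mulrC rpredM.
  by rewrite exprD -mulrA rpredM.
- move=> f' g /asboolP[n Rf] /asboolP[m Rg]; apply/asboolP.
  by exists (n + m)%N; rewrite exprD mulrACA rpredM.
Qed.

Lemma upper_markov_ring : in_upper_cluster_algebra K markov_mx =i R.
Proof.
move=> f; apply/asboolP/idP => [Lf|Rf s rs]; last exact: markov_ring_laurent.
have r0 := @reachable_initial K _ _ markov_mx.
have x0 k : x k != 0 := ratfun_var_neq0 K k.
have Rx := markov_ring_var K.
(* The initial cluster gives [f] a denominator in [x_k Q], its neighbour one in [x_k' Q], with [Q]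
   the product of the two shared variables. As [(x_k, x_k')] is regular, a power of [Q] suffices. *)
have step1 k : exists n, (\prod_(j | j != k) x j) ^+ n * f \in R.
  have [n] := laurent_denominator r0 (Lf _ r0).
  have r1 := reachable_mutate k r0.
  have [m] := laurent_denominator r1 (Lf _ r1).
  have prodD (h : 'I_3 -> F) : \prod_i h i = h k * \prod_(i | i != k) h i.
    exact: bigD1.
  have otherE :
      \prod_(i | i != k) cluster (mutate k (initial_seed K markov_mx)) i
      = \prod_(j | j != k) x j.
    by apply: eq_bigr => i ik; rewrite cluster_mutate_other.
  rewrite !prodD otherE; set Q := \prod_(j | _) _.
  have RQ p : Q ^+ p \in R by apply/rpredX/rpred_prod => j _; apply: Rx.
  have zE : cluster (mutate k (initial_seed K markov_mx)) k = Q * M - x k.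
    rewrite [Q * M]mulrC -(cluster_mutate_sum k r0).
    by rewrite [_ + cluster (mutate _ _) _]addrC addrK.
  have z0 := cluster_neq0 k r1; have Rz := cluster_markov_ring k r1.
  set z := cluster (mutate _ _) k in zE z0 Rz * => Rzf Rxf.
  have xz : regular_pair (x k) z.
    have [j kj _] := ord3_avoid k k; have [l kl jl] := ord3_other kj.
    suff -> : z = x j * x l * M - x k by apply: regular_pair_mutation.
    rewrite zE /Q big_mkcond (big_ord3 _ _ kj kl jl) eqxx /=.
    by rewrite [j == k]eq_sym [l == k]eq_sym (negbTE kj) (negbTE kl) /= mul1r.
  exists (m + n)%N.
  apply: (regular_pair_denominators (n := n) (m := m) z0 (Rx k) Rz xz).
  - move: (rpredM (RQ m) Rxf); rewrite exprMn.
    by rewrite exprD !mulrA [Q ^+ m * _]mulrC.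
  - move: (rpredM (RQ n) Rzf); rewrite exprMn.
    by rewrite exprD [Q ^+ m * _]mulrC !mulrA [Q ^+ n * _]mulrC.
(* Comparing the denominators in [x_i x_l] and [x_i x_j] through the regular pair [(x_j, x_l)]
   leaves a power of [x_i]. *)
have step2 i : exists n, x i ^+ n * f \in R.
  have [j ij _] := ord3_avoid i i; have [l il jl] := ord3_other ij.
  have lj : l != j by rewrite eq_sym.
  have [n] := step1 j; have [m] := step1 l.
  have -> : \prod_(k | k != j) x k = x i * x l.
    by rewrite big_mkcond (big_ord3 _ _ ij il jl) eqxx /= ij lj mul1r.
  have -> : \prod_(k | k != l) x k = x i * x j.
    by rewrite big_mkcond (big_ord3 _ _ ij il jl) eqxx /= il jl mulr1.
  rewrite !exprMn => Rj Rl; exists (n + m)%N.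
  apply: (regular_pair_denominators (n := m) (m := n) (x0 l) (Rx j) (Rx l)).
  - exact: regular_pair_vars.
  - by rewrite exprD -mulrA mulrCA rpredM ?rpredX // mulrCA mulrA.
  - by rewrite addnC exprD -mulrA mulrCA rpredM ?rpredX // mulrCA mulrA.
(* Two different variables form a regular pair, so no denominator is left. *)
have [[n Rn] [m Rm]] := (step2 ord0, step2 ord_max).
apply: (regular_pair_denominators _ _ _ _ Rn Rm) => //.
exact: regular_pair_vars.
Qed.

End MarkovUpper.

(** * Values of ambient elements at a point of the spectrum *)

Section PointEvaluation.
Variables (K : fieldType) (V : comAlgType K) (P : subalgClosed V).
Variable p : {lrmorphism subalg_type P -> K^o}.

(* Outside [P] this has the junk value [0]. *)
Definition point_eval (f : V) : K := p (insubd (0 : subalg_type P) f).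

Lemma point_evalE (a : subalg_type P) : point_eval (val a) = p a.
Proof. by rewrite /point_eval valKd. Qed.

Lemma point_evalD f g : f \in P -> g \in P ->
  point_eval (f + g) = point_eval f + point_eval g.
Proof.
move=> Pf Pg; rewrite -[f](SubK (subalg_type P) Pf).
rewrite -[g](SubK (subalg_type P) Pg).
by rewrite -rmorphD !point_evalE rmorphD.
Qed.

Lemma point_evalM f g : f \in P -> g \in P ->
  point_eval (f * g) = point_eval f * point_eval g.
Proof.
move=> Pf Pg; rewrite -[f](SubK (subalg_type P) Pf).
rewrite -[g](SubK (subalg_type P) Pg).
by rewrite -rmorphM !point_evalE rmorphM.
Qed.

End PointEvaluation.

(** * Vanishing patterns at deep points, for both algebras at once *)

Section DeepPoints.
Variable K : numFieldType.
Local Notation reach := (@reachable K 3 0 markov_mx).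
Implicit Types s : seed K 3 0.
Variable P : subalgClosed (ratfun K (3 + 0)).
Hypothesis clusterP : forall s i, reach s -> cluster s i \in P.
Variable p : spec_point P.
Hypothesis deep : deep_locus markov_mx P p.
Local Notation value s i := (point_eval p (cluster s i)).

Lemma point_eval_exchange s k i j : reach s -> i != k -> j != k -> i != j ->
  value (mutate k s) k * value s k = value s i ^+ 2 + value s j ^+ 2.
Proof.
move=> rs ik jk ij; have rs' := reachable_mutate k rs.
have Pz l : cluster s l \in P by apply: clusterP.
rewrite !expr2 -!point_evalM ?clusterP // -point_evalD ?rpredM //.
rewrite cluster_exchange // big_mkcond.
rewrite (@big_ord3 _ _ _ _ k i j) ?[k == _]eq_sym //=.
by rewrite eqxx ik jk add0r !expr2.
Qed.

Definition all_vanish s := forall i, value s i = 0.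
Definition only_vanishes i s :=
  value s i = 0 /\ forall j, j != i -> value s j != 0.

(** A deep point lies outside the torus of [s], so some variable vanishes. If two vanish, the
    exchange relation in the direction of one of them makes the square of the third vanish. *)
Lemma deep_cluster s : reach s -> all_vanish s \/ exists i, only_vanishes i s.
Proof.
move=> rs.
have [i vi] : exists i, value s i = 0.
  apply: contrapT => nv; apply: (deep rs) => i.
  have Pz : (cluster s i : ratfun K (3 + 0)) \in P by apply: clusterP.
  exists (Sub (cluster s i) Pz) => //.
  by apply/eqP => pz; apply: nv; exists i; rewrite -pz -point_evalE.
have [oi|] := pselect (only_vanishes i s); first by right; exists i.
move=> noi; left.
have [j ji vj] : exists2 j, j != i & value s j = 0.
  apply: contrapT => nj; apply: noi; split=> // j ji.
  by apply/eqP => vj; apply: nj; exists j.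
have ij : i != j by rewrite eq_sym.
have [l il jl] := ord3_other ij.
have li : l != i by rewrite eq_sym.
have vl : value s l = 0.
  have := point_eval_exchange rs ji li jl; rewrite vi vj mulr0 expr0n add0r.
  by move/esym/eqP; rewrite expf_eq0 => /eqP.
move=> k; have [->//|ki] := eqVneq k i; have [->//|kj] := eqVneq k j.
by rewrite (ord3_third ij il jl ki kj).
Qed.

(** Mutation keeps two of the three values, and the new cluster again has one of the two patterns;
    the kept values decide which pattern and, in the second one, which position. *)
Lemma deep_clusters :
  (forall s, reach s -> all_vanish s) \/
  exists i, forall s, reach s -> only_vanishes i s.
Proof.
have r0 := @reachable_initial K _ _ markov_mx.
have other k s j : reach s -> j != k -> value (mutate k s) j = value s j.
  by move=> rs jk; rewrite cluster_mutate_other.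
have [v0|[i v0]] := deep_cluster r0; [left | right; exists i];
  move=> s; elim=> [//|k s' rs' IH].
- have [//|[i [_ oi]]] := deep_cluster (reachable_mutate k rs').
  (* Position [j] is untouched by the mutation, so its value is still zero, although only position
     [i] should vanish. *)
  have [j ij kj] := ord3_avoid i k; rewrite eq_sym in ij; rewrite eq_sym in kj.
  by have /eqP := oi j ij; rewrite other // IH.
- have [vi nv] := IH.
  have [v|[i' [vi' oi']]] := deep_cluster (reachable_mutate k rs').
    have [j ij kj] := ord3_avoid i k.
    rewrite eq_sym in ij; rewrite eq_sym in kj.
    by have := nv j ij; rewrite -(other k) // v eqxx.
  suff <- : i' = i by exact: conj vi' oi'.
  have [ik|ik] := eqVneq i k.
    subst k; apply/eqP; apply: contraT => i'i.
    by have := nv i' i'i; rewrite -(other i) // vi' eqxx.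
  apply/eqP; rewrite eq_sym; apply: contraT => /oi'.
  by rewrite other // vi eqxx.
Qed.

End DeepPoints.

(** * Sign automorphisms of the cluster algebra and the upper cluster algebra *)

Section MarkovAutomorphisms.
Variable K : numFieldType.
Local Notation x := (@ratfun_var K 3).
Local Notation M := (markov_elt K).
Local Notation A := (in_cluster_algebra K markov_mx).
Local Notation U := (in_upper_cluster_algebra K markov_mx).
Local Notation reach := (@reachable K 3 0 markov_mx).
Implicit Types s : seed K 3 0.

Lemma cluster_generatorP (f : ratfun K (3 + 0)) :
  cluster_generator markov_mx f ->
  exists s (i : 'I_3), reach s /\ f = cluster s i.
Proof.
case=> [[s [i [rs ->]]]|[[]]//]; exists s, i; split=> //.
by rewrite lshift0E.
Qed.

Lemma mem_cluster_algebra s i : reach s -> cluster s i \in A.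
Proof.
move=> rs; apply: mem_generated_subalg; left; exists s, i; split=> //.
by rewrite lshift0E.
Qed.

Lemma mem_upper_cluster s i : reach s -> cluster s i \in U.
Proof. by move=> rs; rewrite upper_markov_ring cluster_markov_ring. Qed.

Section Sign.
Variable b : 'I_3 -> bool.
Local Notation Phi := (@ratfun_sign K 3 b).

(** Exchange polynomials are sums of squares, hence blind to signs, so [z_k'] acquires the same sign
    as [z_k]. *)
Lemma ratfun_sign_cluster s i : reach s ->
  Phi (cluster s i) = (-1) ^+ b i *: cluster s i.
Proof.
move=> rs; elim: rs i => [|k s' rs IH] i; first exact: ratfun_sign_var.
have [->|ik] := eqVneq i k; last by rewrite cluster_mutate_other.
rewrite cluster_mutate_same // rmorphM fmorphV /= IH.
rewrite invrZ ?unitfE ?signr_eq0 ?cluster_neq0 // invr_sign -scalerAl.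
congr (_ *: (_ * _)); rewrite rmorph_sum; apply: eq_bigr => j _.
by rewrite rmorphXn /= IH exprZn sqrr_sign scale1r.
Qed.

(** Only the denominator of [M] sees the signs: [M] is fixed exactly by an even number of sign
    changes, a point that matters for the stabilizers in [Spec U]. *)
Lemma ratfun_sign_markov_elt :
  Phi M = (-1) ^+ (\sum_i b i)%N *: M.
Proof.
rewrite /markov_elt fmorph_div /= rmorph_sum rmorph_prod.
have -> : \sum_i Phi (x i ^+ 2) = \sum_i x i ^+ 2.
  apply: eq_bigr => i _.
  by rewrite rmorphXn /= ratfun_sign_var exprZn sqrr_sign scale1r.
have -> : \prod_i Phi (x i) = (-1) ^+ (\sum_i b i)%N *: \prod_i x i.
  rewrite -prodrXr -scaler_prod; apply: eq_bigr => i _.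
  exact: ratfun_sign_var.
rewrite invrZ ?unitfE ?signr_eq0 //; last first.
  by rewrite prodf_seq_neq0; apply/allP => k _; rewrite ratfun_var_neq0.
by rewrite -signr_odd invr_sign scalerAr.
Qed.

Lemma ratfun_sign_cluster_algebra : {in A, forall f, Phi f \in A}.
Proof.
apply: generated_subalg_morph => f /cluster_generatorP[s [i [rs ->]]].
by rewrite /= ratfun_sign_cluster // rpredZ // mem_cluster_algebra.
Qed.

Lemma ratfun_sign_upper : {in U, forall f, Phi f \in U}.
Proof.
move=> f; rewrite !upper_markov_ring; move: f.
apply: generated_subalg_morph => _ [->|[i ->]].
  by rewrite /= ratfun_sign_markov_elt rpredZ // markov_ring_elt.
by rewrite /= ratfun_sign_var rpredZ // markov_ring_var.
Qed.

Definition sign_automorphism :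
    {lrmorphism cluster_algebra K markov_mx -> cluster_algebra K markov_mx} :=
  subalg_restr ratfun_sign_cluster_algebra.

Definition upper_sign_automorphism :
    {lrmorphism upper_cluster_algebra K markov_mx ->
                upper_cluster_algebra K markov_mx} :=
  subalg_restr ratfun_sign_upper.

Lemma sign_automorphismP : cluster_automorphism sign_automorphism.
Proof.
split.
  by exists sign_automorphism; apply/subalg_restr_involutive/ratfun_signK.
move=> s i a rs aE; exists ((-1) ^+ b i); first by rewrite signr_eq0.
by apply: val_inj; rewrite linearZ /= aE; apply: ratfun_sign_cluster.
Qed.

Lemma sign_automorphism_neq_id i : b i -> ~ sign_automorphism =1 id.
Proof.
move=> bi eq_id.
have r0 := @reachable_initial K _ _ markov_mx.
have := val_subalg_restr ratfun_sign_cluster_algebra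
  (Sub (cluster _ i) (mem_cluster_algebra i r0)).
rewrite -/sign_automorphism eq_id SubK => /esym.
rewrite [LHS]ratfun_sign_cluster // => /eqP.
rewrite bi expr1 scaleN1r eq_sym -subr_eq0 opprK -mulr2n.
by rewrite -scaler_nat scaler_eq0 pnatr_eq0 (negbTE (cluster_neq0 i r0)).
Qed.

Lemma sign_acts_on_upper :
  acts_on_upper sign_automorphism upper_sign_automorphism.
Proof. by exists Phi. Qed.

End Sign.
End MarkovAutomorphisms.

(** * Equality of deep and stabilizer loci *)

Section MarkovLoci.
Variable K : numFieldType.
Local Notation x := (@ratfun_var K 3).
Local Notation M := (markov_elt K).
Local Notation A := (in_cluster_algebra K markov_mx).
Local Notation U := (in_upper_cluster_algebra K markov_mx).
Local Notation CA := (cluster_algebra K markov_mx).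
Local Notation reach := (@reachable K 3 0 markov_mx).
Implicit Types s : seed K 3 0.

Definition fixes_cluster (phi : CA -> CA) s :=
  forall i (a : CA), val a = cluster s i -> phi a = a.

Section Fixing.
Variable phi : {lrmorphism CA -> CA}.

Let CA_mulIf (a b c : CA) : val c != 0 -> a * c = b * c -> a = b.
Proof.
move=> c0 /(congr1 val); rewrite !rmorphM => /(mulIf c0) ab; exact: val_inj.
Qed.

Let fixes_factor (a b c : CA) : val b != 0 -> a * b = c ->
  phi b = b -> phi c = c -> phi a = a.
Proof.
by move=> b0 <- eb eab; apply: (CA_mulIf b0); rewrite -[in LHS]eb -rmorphM.
Qed.

(** In [z_k' z_k = S], [S] involves only the shared variables; so an endomorphism fixing these and
    one factor fixes the other, by cancellation in the ambient field. *)
Lemma fixes_cluster_mutate k s : reach s ->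
  fixes_cluster phi s <-> fixes_cluster phi (mutate k s).
Proof.
move=> rs; have rs' := reachable_mutate k rs.
pose el s (rs : reach s) i : CA := Sub (cluster s i) (mem_cluster_algebra i rs).
pose S : CA := \sum_(j | j != k) el s rs j ^+ 2.
have valS : val S = \sum_(j | j != k) cluster s j ^+ 2.
  by rewrite rmorph_sum; apply: eq_bigr => j _; rewrite rmorphXn.
have zz' : el _ rs' k * el _ rs k = S.
  by apply: val_inj; rewrite valS rmorphM -cluster_exchange.
have fixS : (forall j, j != k -> phi (el s rs j) = el s rs j) -> phi S = S.
  move=> fj; rewrite rmorph_sum; apply: eq_bigr => j jk.
  by rewrite rmorphXn /= fj.
split=> fs i a; have [->|ik] := eqVneq i k => aE.
- have -> : a = el _ rs' k by apply: val_inj; rewrite aE.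
  apply: (fixes_factor _ zz'); first exact: cluster_neq0.
    exact: (fs k).
  by apply: fixS => j _; apply: (fs j).
- by apply: (fs i); rewrite aE cluster_mutate_other.
- have -> : a = el _ rs k by apply: val_inj; rewrite aE.
  rewrite mulrC in zz'; apply: (fixes_factor _ zz'); first exact: cluster_neq0.
    exact: (fs k).
  by apply: fixS => j jk; apply: (fs j); rewrite cluster_mutate_other.
- by apply: (fs i); rewrite aE cluster_mutate_other.
Qed.

(** From [s] one mutates back to the initial seed, then forward to every seed; this is why both
    directions of [fixes_cluster_mutate] are used. *)
Lemma fixes_cluster_id s : reach s -> fixes_cluster phi s -> phi =1 id.
Proof.
move=> rs fs; have f0 : fixes_cluster phi (initial_seed K markov_mx).
  by elim: rs fs => [//|k s' rs' IH] /(fixes_cluster_mutate k rs').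
have fall s' : reach s' -> fixes_cluster phi s'.
  by elim=> [//|k s'' rs'' IH]; apply/(fixes_cluster_mutate k rs'').
apply: (@lrmorphism_eq_on_generators _ _ (cluster_generator markov_mx) A CA
  phi idfun) => //.
  by move=> g Gg; apply: mem_generated_subalg.
by move=> a /cluster_generatorP[s' [i [rs' aE]]]; apply: (fall s' rs' i).
Qed.

End Fixing.

Lemma deep_locus_algebra :
  deep_locus markov_mx A = stabilizer_locus K markov_mx.
Proof.
apply/seteqP; split=> p.
  move=> deep.
  (* Both patterns provide a position vanishing in all clusters. As [A] is generated by cluster
     variables, changing the sign at that single position fixes the point. *)
  have [i vi] : exists i, forall s, reach s -> point_eval p (cluster s i) = 0.
    have [av|[i oi]] := deep_clusters (@mem_cluster_algebra K) deep.
      by exists ord0 => s rs; apply: av.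
    by exists i => s /oi[].
  exists (sign_automorphism K (pred1 i)); split.
  - exact: sign_automorphismP.
  - by apply: (@sign_automorphism_neq_id _ _ i); rewrite /= eqxx.
  apply: (@lrmorphism_eq_on_generators _ _ (cluster_generator markov_mx) A K^o
    (p \o sign_automorphism K (pred1 i)) p) => //.
    by move=> g Gg; apply: mem_generated_subalg.
  move=> a /cluster_generatorP[s [j [rs aE]]] /=.
  have -> : sign_automorphism K (pred1 i) a = (-1) ^+ (j == i) *: a.
    by apply: val_inj; rewrite linearZ /= aE; apply: ratfun_sign_cluster.
  case: eqP => [ji|_]; last by rewrite scale1r.
  by rewrite linearZ /= -point_evalE aE ji vi // scaler0.
move=> [phi [[_ phiP] nid fixp]] s rs tor; apply: nid.
(* On the torus, [p] is nonzero on the variable that [phi] scales by [c], so invariance of [p]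
   forces [c = 1]. *)
apply: (fixes_cluster_id rs) => i a aE.
have [c _ phia] := phiP s i a rs aE.
have [a' a'E pa0] := tor i.
have aa' : a' = a by apply: val_inj; rewrite a'E aE.
have := fixp a; rewrite /= phia linearZ /= -aa' => /eqP.
rewrite -subr_eq0 -[X in _ - X]scale1r -scalerBl scaler_eq0 (negbTE pa0) orbF.
by rewrite subr_eq0 => /eqP ->; rewrite scale1r.
Qed.

Lemma deep_locus_upper :
  deep_locus markov_mx U = upper_stabilizer_locus K markov_mx.
Proof.
apply/seteqP; split=> p; last first.
  move=> [phi [psi [[_ phiP] nid [Phi [PhiA PhiU]] fixp]]] s rs tor; apply: nid.
  apply: (fixes_cluster_id rs) => i a aE.
  have [c _ phia] := phiP s i a rs aE.
  have [u uE pu0] := tor i.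
  (* The same variable seen in [U] is scaled by the same [c], since [phi] and [psi] both restrict
     [Phi]. *)
  have psiu : psi u = c *: u.
    apply: val_inj; rewrite -PhiU uE -[seed_var s i]aE PhiA phia !linearZ /=.
    by rewrite uE aE.
  have := fixp u; rewrite /= psiu linearZ /= => /eqP.
  rewrite -subr_eq0 -[X in _ - X]scale1r -scalerBl scaler_eq0 (negbTE pu0) orbF.
  by rewrite subr_eq0 => /eqP c1; rewrite phia c1 scale1r.
move=> deep; have r0 := @reachable_initial K _ _ markov_mx.
(* It is enough to compare the values at the generators [x_j] and [M] of [U]. *)
have stab (b : 'I_3 -> bool) i : b i ->
    (forall j, (-1) ^+ b j * point_eval p (x j) = point_eval p (x j)) ->
    (-1) ^+ (\sum_i b i)%N * point_eval p M = point_eval p M ->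
    upper_stabilizer_locus K markov_mx p.
  move=> bi px pM.
  exists (sign_automorphism K b), (upper_sign_automorphism K b).
  split; [exact: sign_automorphismP | exact: sign_automorphism_neq_id bi |
          exact: sign_acts_on_upper |].
  apply: (@lrmorphism_eq_on_generators _ _
     (fun f : ratfun K (3 + 0) => f = M \/ exists i, f = x i) U K^o
     (p \o upper_sign_automorphism K b) p).
  - by move=> f; rewrite upper_markov_ring.
  - by move=> g Gg; rewrite upper_markov_ring; apply: mem_generated_subalg.
  move=> a [aE|[j aE]] /=.
    have -> : upper_sign_automorphism K b a = (-1) ^+ (\sum_i b i)%N *: a.
      by apply: val_inj; rewrite linearZ /= aE; apply: ratfun_sign_markov_elt.
    by rewrite linearZ /= -point_evalE aE; apply: pM.
  have -> : upper_sign_automorphism K b a = (-1) ^+ b j *: a.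
    by apply: val_inj; rewrite linearZ /= aE; apply: ratfun_sign_var.
  by rewrite linearZ /= -point_evalE aE; apply: px.
have [av|[i oi]] := deep_clusters (@mem_upper_cluster K) deep.
  (* Here [M] may take a nonzero value, so two signs are changed in order to fix [M]. *)
  apply: (stab (predC1 ord0) ord_max) => // [j|].
    by rewrite (av _ r0 j) mulr0.
  by rewrite !big_ord_recl big_ord0 /= sqrrN expr1n mul1r.
apply: (stab (pred1 i) i) => [|j|]; first by rewrite /= eqxx.
  have [vi _] := oi _ r0.
  rewrite /=; case: eqP => [->|_]; last by rewrite mul1r.
  by rewrite [point_eval _ _]vi mulr0.
(* A single sign change negates [M], so [M] has to vanish at [p]. It does: in
   [x_i + x_i' = M x_j x_l] the left side vanishes, while [x_j] and [x_l] do not. *)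
suff -> : point_eval p M = 0 by rewrite mulr0.
have r1 := reachable_mutate i r0.
have [j ij _] := ord3_avoid i i; have ji : j != i by rewrite eq_sym.
have [l il jl] := ord3_other ij; have li : l != i by rewrite eq_sym.
have UM : M \in U by rewrite upper_markov_ring markov_ring_elt.
have Ux k : x k \in U := mem_upper_cluster k r0.
have prodE :
    \prod_(k | k != i) cluster (initial_seed K markov_mx) k = x j * x l.
  by rewrite big_mkcond (big_ord3 _ _ ij il jl) eqxx /= ji li mul1r.
have := congr1 (point_eval p) (cluster_mutate_sum i r0).
rewrite prodE point_evalD ?mem_upper_cluster //.
have [[-> oi0] [-> _]] := (oi _ r0, oi _ r1).
rewrite (point_evalM _ UM (rpredM (Ux j) (Ux l))).
rewrite (point_evalM _ (Ux j) (Ux l)).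
rewrite addr0 => /esym/eqP; rewrite !mulf_eq0.
by rewrite (negbTE (oi0 j ji)) (negbTE (oi0 l li)) !orbF => /eqP.
Qed.

End MarkovLoci.

Local Open Scope complex_scope.

Theorem proposition3p21 (R : realType) :
  deep_locus markov_mx (in_cluster_algebra R[i] markov_mx)
    = stabilizer_locus R[i] markov_mx
  /\
  deep_locus markov_mx (in_upper_cluster_algebra R[i] markov_mx)
    = upper_stabilizer_locus R[i] markov_mx.
Proof.
split; [exact: (@deep_locus_algebra R[i]) | exact: (@deep_locus_upper R[i])].
Qed.
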